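(* Let $\hat\omega_N$ be an estimator of the data $\omega^\star$ based on $N$ samples and $\hat\lambda_N:=\lambda^\star(\hat\omega_N)$ the multiplier obtained by solving (P$_\omega$) at $\omega=\hat\omega_N$. Assume: (i) (Sub-Gaussian estimator.) For some proxy $\sigma^2>0$ and absolute constant $c_0>0$, $$\mathbb{P}\bigl(\|\hat\omega_N-\omega^\star\|_2>t\bigr)\le2\exp\Bigl(-\frac{c_0Nt^2}{\sigma^2}\Bigr),\qquad t>0.$$ (ii) (Local Lipschitz solution map.) The KKT solution map $\omega\mapsto\lambda^\star(\omega)$ is $\kappa$-Lipschitz on a neighborhood of $\omega^\star$. (iii) (Margin condition.) $\lambda^\star:=\lambda^\star(\omega^\star)\in\mathcal{R}_r^\circ$ with feature margin $\rho_r(\lambda^\star)>0$. Then for any confidence parameter $\alpha\in(0,1)$, if the sample size satisfies $$N\ge N_0(\alpha):=\frac{\sigma^2C_\Psi^2\kappa^2}{c_0\,\rho_r(\lambda^\star)^2}\log\frac2\alpha,$$ then the classifier applied to the empirical solution returns the correct regime with high probability: $$\mathbb{P}\bigl(\Psi(\hat\lambda_N)=r\bigr)\ge1-\alpha.$$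
   Context: Problem (P$_\omega$), $\omega\in\Omega\subset\mathbb{R}^d$: minimize $f(x;\omega)$ over $x\in\mathbb{R}^n$ subject to $g_i(x;\omega)\le0$ ($i=1,\dots,m$), $h_j(x;\omega)=0$ ($j=1,\dots,p$), with $f,g_i,h_j$ at least $C^2$ jointly in $(x,\omega)$. The KKT solution map assigns to $\omega$ the inequality multiplier vector $\lambda^\star(\omega)\in\mathbb{R}^m_+$ of a KKT triple of (P$_\omega$), i.e. $(x^\star,\lambda^\star,\mu^\star)$ with $\nabla f+\sum_i\lambda_i^\star\nabla g_i+\sum_j\mu_j^\star\nabla h_j=0$; $g_i\le0$, $\lambda^\star_i\ge0$, $\lambda_i^\star g_i=0$; $h_j=0$ at $x^\star$. Standing assumption: at the KKT triple for $\omega^\star$, LICQ holds (gradients of active inequality constraints and of equality constraints linearly independent) and SOSC holds (Hessian in $x$ of the Lagrangian $f+\sum\lambda_i^\star g_i+\sum\mu_j^\star h_j$ is positive on nonzero $d$ with $\nabla g_i^\top d\le0$ for active $i$, $\nabla g_i^\top d=0$ for $i$ with $\lambda_i^\star\ne0$, $\nabla h_j^\top d=0$ for all $j$), together with strict complementarity ($\lambda^\star_i>0$ for every active $i$). For $\lambda\in\mathbb{R}^m_+$ let $L(\lambda)=\sum_i\lambda_i$; $\bar\lambda=\lambda/L(\lambda)$ if $L(\lambda)>0$, $\bar\lambda=0$ otherwise; $\bar\lambda_{(1)}\ge\cdots\ge\bar\lambda_{(m)}$ the sorted entries. Fix $\Theta=(\delta,\theta,\gamma,k)$ with $0<\delta<\tfrac12$,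 $\theta\in(\tfrac12,1)$, $\gamma\in(0,1)$, $k\in\{1,\dots,m-1\}$. $\Sigma_k(\lambda)=\sum_{j=1}^k\bar\lambda_{(j)}$, $\sigma_\delta(\lambda)=\frac1m|\{i:\bar\lambda_i>\delta\}|$, $\tau(\lambda)=\bar\lambda_{(2)}$. Core regimes in $\mathbb{R}^m_+$: $\mathcal{R}_{\mathrm{unc}}^\circ=\{L<\delta\}$; $\mathcal{R}_{\mathrm{res}}^\circ=\{L>\delta,\Sigma_k>\theta\}$; $\mathcal{R}_{\mathrm{sat}}^\circ=\{L>\delta,\Sigma_k<\theta,\sigma_\delta>\gamma\}$; $\mathcal{R}_{\mathrm{coup}}^\circ=\{L>\delta,\Sigma_k<\theta,\sigma_\delta<\gamma,\tau>\delta\}$. $\Psi(\lambda)$ is the unique $r\in\{\mathrm{unc},\mathrm{res},\mathrm{sat},\mathrm{coup}\}$ with $\lambda\in\mathcal{R}_r^\circ$ if it exists, and $\mathrm{hyb}$ otherwise. Feature margin: for $\lambda^\star\in\mathcal{R}_r^\circ$, $\rho_r(\lambda^\star)$ is the minimum of those among $|L(\lambda^\star)-\delta|$, $|\Sigma_k(\lambda^\star)-\theta|$, $|\sigma_\delta(\lambda^\star)-\gamma|$, $|\tau(\lambda^\star)-\delta|$ whose corresponding inequality appears in the definition of $\mathcal{R}_r^\circ$. $C_\Psi$ is the (finite) joint Lipschitz constant of $\lambda\mapsto(L,\Sigma_k,\sigma_\delta,\tau)$ on a bounded neighborhood of $\lambda^\star$ (from $\|\cdot\|_2$ to $\|\c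dot\|_\infty$).
   Formalization: Added assumption: whenever C_Ψ κ‖ω̂_N−ω*‖ < ρ_r(λ* ), ω̂_N lies in the neighborhood of (ii) and λ̂_N in the one defining C_Ψ; without it the claim fails, as N_0 ignores the size of these neighborhoods. *)

(* Defs.v *)
From HB Require Import structures.
From mathcomp Require Import all_boot all_order all_algebra.
From mathcomp Require Import all_classical all_reals all_analysis.

Set Implicit Arguments.
Unset Strict Implicit.
Unset Printing Implicit Defensive.

Import Order.TTheory GRing.Theory Num.Theory.
Import numFieldNormedType.Exports.

Local Open Scope classical_set_scope.
Local Open Scope ring_scope.

Section Calculus.
Context {R : realType}.

(* The library norm on 'rV[R]_n is the max norm; this is the Euclidean one. *)
Definition norm2 n (v : 'rV[R]_n) : R := Num.sqrt (\sum_(i < n) v 0 i ^+ 2).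

Definition dot n (u v : 'rV[R]_n) : R := \sum_(i < n) u 0 i * v 0 i.

Definition grad n (f : 'rV[R]_n -> R) (x : 'rV[R]_n) : 'rV[R]_n :=
  \row_(i < n) 'D_(delta_mx 0 i) f x.

Definition hess n (f : 'rV[R]_n -> R) (x : 'rV[R]_n) : 'M[R]_n :=
  \matrix_(i < n, j < n) 'D_(delta_mx 0 i) ('D_(delta_mx 0 j) f) x.

(* In finite dimension, continuity of all first (resp. second) directional
   derivatives amounts to continuity of the partial derivatives. *)
Definition C1_on (V : normedModType R) (O : set V) (f : V -> R) : Prop :=
  forall v z, O z -> derivable f z v /\ {for z, continuous ('D_v f)}.

Definition C2_on (V : normedModType R) (O : set V) (f : V -> R) : Prop :=
  C1_on O f /\ forall v, C1_on O ('D_v f).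

(* On a set A that need not be open, C^2 means C^2 on an open superset. *)
Definition C2 (V : normedModType R) (A : set V) (f : V -> R) : Prop :=
  exists O : set V, [/\ open O, A `<=` O & C2_on O f].

End Calculus.

Section Program.
Context {R : realType}.

(* Parametric program: minimize f(x; w) subject to g_i(x; w) <= 0 for i < m
   and h_j(x; w) = 0 for j < p, with x in R^n and w in R^d. *)
Record program (n d m p : nat) := Program {
  objf : 'rV[R]_n -> 'rV[R]_d -> R ;
  ineq : 'I_m -> 'rV[R]_n -> 'rV[R]_d -> R ;
  eqc  : 'I_p -> 'rV[R]_n -> 'rV[R]_d -> R }.

Variables (n d m p : nat) (Q : program n d m p).

Definition C2_program (Omega : set 'rV[R]_d) : Prop :=
  let A : set ('rV[R]_n * 'rV[R]_d)%type := [set z | Omega z.2] in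
  [/\ C2 A (fun z => objf Q z.1 z.2),
      forall i, C2 A (fun z => ineq Q i z.1 z.2)
    & forall j, C2 A (fun z => eqc Q j z.1 z.2)].

Definition lagrangian (w : 'rV[R]_d) (lam : 'rV[R]_m) (mu : 'rV[R]_p)
    (x : 'rV[R]_n) : R :=
  objf Q x w + \sum_(i < m) lam 0 i * ineq Q i x w
             + \sum_(j < p) mu 0 j * eqc Q j x w.

Definition grad_f w x := grad (fun y => objf Q y w) x.
Definition grad_g i w x := grad (fun y => ineq Q i y w) x.
Definition grad_h j w x := grad (fun y => eqc Q j y w) x.

Definition KKT (w : 'rV[R]_d) (x : 'rV[R]_n) (lam : 'rV[R]_m)
    (mu : 'rV[R]_p) : Prop :=
  [/\ grad_f w x + \sum_(i < m) lam 0 i *: grad_g i w x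
                 + \sum_(j < p) mu 0 j *: grad_h j w x = 0,
      forall i, [/\ ineq Q i x w <= 0, 0 <= lam 0 i
                  & lam 0 i * ineq Q i x w = 0]
    & forall j, eqc Q j x w = 0].

Definition active w x (i : 'I_m) : bool := ineq Q i x w == 0.

Definition LICQ w x : Prop :=
  free ([seq grad_g i w x | i <- enum 'I_m & active w x i]
        ++ [seq grad_h j w x | j <- enum 'I_p]).

Definition critical w x (lam : 'rV[R]_m) (v : 'rV[R]_n) : Prop :=
  [/\ forall i, active w x i -> dot (grad_g i w x) v <= 0,
      forall i, lam 0 i != 0 -> dot (grad_g i w x) v = 0
    & forall j, dot (grad_h j w x) v = 0].

Definition SOSC w x lam mu : Prop :=
  forall v, v != 0 -> critical w x lam v ->
    0 < dot (v *m hess (lagrangian w lam mu) x) v.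

Definition strict_complementarity w x (lam : 'rV[R]_m) : Prop :=
  forall i, active w x i -> 0 < lam 0 i.

(* The multiplier map on Omega: lam w is the inequality multiplier of some KKT
   triple at w; its values outside Omega are irrelevant. *)
Definition KKT_solution_map (Omega : set 'rV[R]_d)
    (lam : 'rV[R]_d -> 'rV[R]_m) : Prop :=
  forall w, Omega w -> exists x mu, KKT w x (lam w) mu.

End Program.

Section Regimes.
Context {R : realType}.

Record thresholds := Thresholds {
  delta : R ; theta : R ; gamma : R ; topk : nat }.

Definition valid_thresholds (m : nat) (Th : thresholds) : Prop :=
  [/\ 0 < delta Th < 2^-1, 2^-1 < theta Th < 1, 0 < gamma Th < 1
    & (0 < topk Th < m)%N].

Variables (m : nat) (Th : thresholds).

Definition orthant : set 'rV[R]_m := [set lam | forall i, 0 <= lam 0 i].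

Definition load (lam : 'rV[R]_m) : R := \sum_(i < m) lam 0 i.

Definition normalized (lam : 'rV[R]_m) : 'rV[R]_m :=
  if 0 < load lam then (load lam)^-1 *: lam else 0.

(* 0-based: nth 0 (sorted_entries lam) j is the (j+1)-st largest entry. *)
Definition sorted_entries (lam : 'rV[R]_m) : seq R :=
  sort >=%R [seq normalized lam 0 i | i <- enum 'I_m].

Definition topk_share (lam : 'rV[R]_m) : R :=
  \sum_(j < topk Th) nth 0 (sorted_entries lam) j.

Definition saturation (lam : 'rV[R]_m) : R :=
  #|[pred i : 'I_m | delta Th < normalized lam 0 i]|%:R / m%:R.

Definition second (lam : 'rV[R]_m) : R := nth 0 (sorted_entries lam) 1.

(* The library norm on products is the max norm, as wanted for features. *)
Definition features (lam : 'rV[R]_m) : R * R * R * R :=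
  (load lam, topk_share lam, saturation lam, second lam).

Inductive core_regime := Unc | Res | Sat | Coup.

Inductive regime := Core of core_regime | Hyb.

Definition core (r : core_regime) : set 'rV[R]_m :=
  [set lam | orthant lam /\
    match r with
    | Unc => load lam < delta Th
    | Res => load lam > delta Th /\ topk_share lam > theta Th
    | Sat => [/\ load lam > delta Th, topk_share lam < theta Th
               & saturation lam > gamma Th]
    | Coup => [/\ load lam > delta Th, topk_share lam < theta Th,
                  saturation lam < gamma Th & second lam > delta Th]
    end].

Definition Psi (lam : 'rV[R]_m) : regime :=
  if pselect (exists! r, core r lam) is left ex then Core (sval (cid ex))
  else Hyb.

Definition margin (r : core_regime) (lam : 'rV[R]_m) : R :=
  let mL := `|load lam - delta Th| in
  let mS := `|topk_share lam - theta Th| in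
  let ms := `|saturation lam - gamma Th| in
  let mt := `|second lam - delta Th| in
  match r with
  | Unc => mL
  | Res => Num.min mL mS
  | Sat => Num.min mL (Num.min mS ms)
  | Coup => Num.min mL (Num.min mS (Num.min ms mt))
  end.

End Regimes.

Arguments program : clear implicits.
Arguments thresholds : clear implicits.

Section Lipschitz.
Context {R : realType}.

Definition solution_lipschitz d m (A : set 'rV[R]_d)
    (lam : 'rV[R]_d -> 'rV[R]_m) (kappa : R) : Prop :=
  forall w w', A w -> A w' -> norm2 (lam w - lam w') <= kappa * norm2 (w - w').

Definition features_lipschitz m (Th : thresholds R) (A : set 'rV[R]_m)
    (C : R) : Prop :=
  forall l l', A l -> A l' ->
    `|features Th l - features Th l'| <= C * norm2 (l - l').

End Lipschitz.

Section Probability.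
Context {R : realType}.

Definition random_vector disp (T : measurableType disp) d
    (X : T -> 'rV[R]_d) : Prop :=
  forall i, measurable_fun setT (fun t => X t 0 i).

Definition sub_gaussian disp (T : measurableType disp) (P : probability T R)
    d (X : T -> 'rV[R]_d) (mean : 'rV[R]_d) (N : nat) (c0 sigma : R) : Prop :=
  forall s : R, 0 < s ->
    (P [set t | norm2 (X t - mean) > s]%R <=
      (2 * expR (- (c0 * N%:R * s ^+ 2 / sigma ^+ 2)))%:E)%E.

End Probability.

(* Main.v *)
Require Import Defs.
From HB Require Import structures.
From mathcomp Require Import all_boot all_order all_algebra.
From mathcomp Require Import all_classical all_reals all_analysis.
From mathcomp Require Import measurable_realfun.
From mathcomp Require Import ring lra.

(** The argument is perturbative.  When the estimator lands within
    [margin / (CPsi * kappa)] of the true data, composing the two Lipschitz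
    bounds moves every feature of the multiplier by less than the margin.  Each
    inequality defining the core regime [r] has slack at least the margin, so
    none of them can flip ([core_stable]); since the core regimes are pairwise
    disjoint ([core_inj]), the classifier still answers [r] ([Psi_core]).

    Misclassification is therefore contained in the event that the estimation
    error is at least [margin / (CPsi * kappa)], and the lower bound on [N] is
    exactly what makes the sub-Gaussian tail at that radius at most [alpha].

    Two boundary points need care.  The failure event is controlled by a
    non-strict inequality on the error, while the sub-Gaussian hypothesis speaks
    of strict ones; the non-strict tail bound follows by letting the radius
    increase to its limit ([sub_gaussian_closed_tail]).  And when
    [CPsi * kappa = 0] the radius is infinite: the features do not move at all
    and the classification is correct surely. *)

Set Implicit Arguments.
Unset Strict Implicit.
Unset Printing Implicit Defensive.

Import Order.TTheory GRing.Theory Num.Theory.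
Import numFieldNormedType.Exports.

Local Open Scope classical_set_scope.
Local Open Scope ring_scope.

Section Classifier.
Context {R : realType}.
Variables (m : nat) (Th : thresholds R).

(** The defining conditions compare the same features to the same thresholds in
    opposite directions, so two of them never hold together. *)
Lemma core_inj (r1 r2 : core_regime) (l : 'rV[R]_m) :
  core Th r1 l -> core Th r2 l -> r1 = r2.
Proof.
have no (x y : R) : x < y -> y < x -> False.
  by move=> xy yx; have := lt_trans xy yx; rewrite ltxx.
case: r1; case: r2 => //= -[_ h1] [_ h2]; exfalso;
  repeat match goal with
  | h : _ /\ _ |- _ => case: h => ? ?
  | h : and3 _ _ _ |- _ => case: h => ? ? ?
  | h : and4 _ _ _ _ |- _ => case: h => ? ? ? ?
  end; eauto.
Qed.

Lemma Psi_core (r : core_regime) (l : 'rV[R]_m) :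
  core Th r l -> Psi Th l = Core r.
Proof.
move=> rl; rewrite /Psi; case: pselect => [ex|[]].
  by case: cid => r' [/= r'l _]; rewrite (core_inj r'l rl).
by exists r; split => // r' /(core_inj rl).
Qed.

(** A displacement smaller than the distance to a threshold cannot cross it. *)
Lemma above_stable (a b c e : R) :
  c < a -> `|a - b| < e -> e <= `|a - c| -> c < b.
Proof.
move=> ca abe; rewrite gtr0_norm ?subr_gt0// => eac.
by move: (le_lt_trans (ler_norm _) abe); lra.
Qed.

Lemma below_stable (a b c e : R) :
  a < c -> `|a - b| < e -> e <= `|a - c| -> b < c.
Proof.
move=> ac; rewrite (distrC a b) (@ltr0_norm _ (a - c)) ?subr_lt0// => abe eac.
by move: (le_lt_trans (ler_norm _) abe); lra.
Qed.

Lemma features_distE (l l' : 'rV[R]_m) :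
  `|features Th l - features Th l'| =
  Num.max (Num.max (Num.max `|load l - load l'|
    `|topk_share Th l - topk_share Th l'|)
    `|saturation Th l - saturation Th l'|) `|second l - second l'|.
Proof. by []. Qed.

Lemma core_stable (r : core_regime) (l l' : 'rV[R]_m) :
  core Th r l -> orthant l' ->
  `|features Th l - features Th l'| < margin Th r l -> core Th r l'.
Proof.
(* Naming the margin [e] keeps the bounds on the displacements in one form for
   all [r], while its lower-bound property is unfolded case by case. *)
move=> [_ rl] l'0; have [e eE] : {e | e = margin Th r l}.
  by exists (margin Th r l).
rewrite -eE features_distE !gt_max -!andbA => /and4P[dL dS ds dt].
have {eE} : e <= margin Th r l by rewrite eE.
move=> em; split=> //; case: r rl em => /=; rewrite ?le_min.
- by move=> h eL; exact: below_stable h dL eL.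
- move=> [hL hS] /andP[eL eS].
  by split; [exact: above_stable hL dL eL|exact: above_stable hS dS eS].
- move=> [hL hS hs] /and3P[eL eS es].
  by split; [exact: above_stable hL dL eL|exact: below_stable hS dS eS|
             exact: above_stable hs ds es].
- move=> [hL hS hs ht] /and4P[eL eS es et].
  by split; [exact: above_stable hL dL eL|exact: below_stable hS dS eS|
             exact: below_stable hs ds es|exact: above_stable ht dt et].
Qed.

End Classifier.

Section Tails.
Context {R : realType} {disp : measure_display} {T : measurableType disp}.

Lemma measurable_norm2 d (X : T -> 'rV[R]_d) (c : 'rV[R]_d) :
  random_vector X -> measurable_fun setT (fun t => norm2 (X t - c)).
Proof.
move=> mX; apply: (measurableT_comp (f := @Num.sqrt R)).
  by apply: continuous_measurable_fun; exact: sqrt_continuous.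
apply: measurable_sum => i; apply: measurable_funX.
rewrite (_ : (fun _ => _) = (fun t => X t 0 i - c 0 i)); last first.
  by apply/funext => t; rewrite !mxE.
by apply: measurable_funB; [exact: mX|exact: measurable_cst].
Qed.

Lemma measurable_closed_tail d (X : T -> 'rV[R]_d) (c : 'rV[R]_d) (s : R) :
  random_vector X -> measurable [set t | s <= norm2 (X t - c)].
Proof.
move=> mX; rewrite -[X in measurable X]setTI.
have := measurable_norm2 c mX measurableT (measurable_itv `[s, +oo[).
by rewrite set_itvcy.
Qed.

(** The bound is continuous in the radius, and the closed tail at [s] lies in
    every open tail at a smaller radius. *)
Lemma sub_gaussian_closed_tail (P : probability T R) d (X : T -> 'rV[R]_d)
    (mean : 'rV[R]_d) (N : nat) (c0 sigma s : R) :
  random_vector X -> sub_gaussian P X mean N c0 sigma -> 0 < s ->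
  (P [set t | s <= norm2 (X t - mean)]%R <=
    (2 * expR (- (c0 * N%:R * s ^+ 2 / sigma ^+ 2)))%:E)%E.
Proof.
move=> mX subG s0; have mn := measurable_norm2 mean mX.
set A := [set t | _].
have mA : measurable A by exact: measurable_closed_tail.
rewrite -(fineK (fin_num_measure P _ mA)) lee_fin.
pose b (u : R) := 2 * expR (- (c0 * N%:R * u ^+ 2 / sigma ^+ 2)).
have cb : b u @[u --> s^'-] --> b s.
  apply: cvg_at_left_filter; apply: cvgM; first exact: cvg_cst.
  apply: continuous_cvg; first exact: continuous_expR.
  by apply: cvgN; apply: cvgMr_tmp; apply: cvgMl_tmp; exact: exprn_continuous.
apply: (cvgr_to_ge cb); near=> u.
have us : u < s by near: u; exact: nbhs_left_lt.
have u0 : 0 < u by near: u; exact: nbhs_left_gt.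
rewrite -lee_fin (fineK (fin_num_measure P _ mA)).
apply: le_trans (subG _ u0); apply: le_measure; rewrite ?inE//.
  rewrite -[X in measurable X]setTI.
  by have := mn measurableT _ (measurable_itv `]u, +oo[);
    rewrite set_itvoy.
by move=> t /= st; exact: lt_le_trans us st.
Unshelve. all: by end_near. Qed.

(** The hypothesis on [N] is the tail bound at radius [rho / C] solved for [N];
    [C] plays the Lipschitz constant of the map from data to features. *)
Lemma sub_gaussian_sample_size (N c0 sigma C rho alpha : R) :
  0 < c0 -> 0 < sigma -> 0 < C -> 0 < rho -> 0 < alpha ->
  sigma ^+ 2 * C ^+ 2 / (c0 * rho ^+ 2) * ln (2 / alpha) <= N ->
  2 * expR (- (c0 * N * (rho / C) ^+ 2 / sigma ^+ 2)) <= alpha.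
Proof.
move=> c00 s0 C0 rho0 a0 hN.
have alphaE : 2 * expR (- ln (2 / alpha)) = alpha.
  by rewrite expRN lnK ?posrE ?divr_gt0// invf_div mulrC divfK.
rewrite -[leRHS]alphaE ler_pM2l// ler_expR lerN2.
have K0 : 0 < c0 * (rho / C) ^+ 2 / sigma ^+ 2.
  by rewrite !(divr_gt0, mulr_gt0, exprn_gt0).
rewrite (_ : c0 * N * _ / _ = c0 * (rho / C) ^+ 2 / sigma ^+ 2 * N);
  last by ring.
apply: le_trans (ler_wpM2l (ltW K0) hN).
rewrite le_eqVlt; apply/orP; left; apply/eqP; field.
by rewrite !gt_eqF.
Qed.

End Tails.

Theorem theorem14 (R : realType) (n d m p : nat)
  (* the parametric program and its KKT solution map *)
  (Omega : set 'rV[R]_d) (Q : program R n d m p)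
  (hC2 : C2_program Q Omega)
  (lam : 'rV[R]_d -> 'rV[R]_m) (hlam : KKT_solution_map Q Omega lam)
  (ws : 'rV[R]_d) (hws : Omega ws)
  (xs : 'rV[R]_n) (mus : 'rV[R]_p) (hKKT : KKT Q ws xs (lam ws) mus)
  (hLICQ : LICQ Q ws xs) (hSOSC : SOSC Q ws xs (lam ws) mus)
  (hSC : strict_complementarity Q ws xs (lam ws))
  (Th : thresholds R) (hTh : valid_thresholds m Th)
  (* (i) the estimator *)
  (disp : measure_display) (T : measurableType disp) (P : probability T R)
  (N : nat) (omh : T -> 'rV[R]_d)
  (homh : random_vector omh) (hOmega : forall t, Omega (omh t))
  (c0 sigma : R) (hc0 : 0 < c0) (hsigma : 0 < sigma)
  (hsub : sub_gaussian P omh ws N c0 sigma)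
  (* (ii) the solution map is kappa-Lipschitz on a neighbourhood U of ws *)
  (U : set 'rV[R]_d) (hU : nbhs ws U)
  (kappa : R) (hkappa : 0 <= kappa)
  (hlip : solution_lipschitz (U `&` Omega) lam kappa)
  (* (iii) the margin condition *)
  (r : core_regime) (hr : core Th r (lam ws))
  (hrho : 0 < margin Th r (lam ws))
  (* the features are CPsi-Lipschitz on a bounded neighbourhood V of lam ws *)
  (V : set 'rV[R]_m) (hV : nbhs (lam ws) V) (hVb : bounded_set V)
  (CPsi : R) (hCPsi : 0 <= CPsi)
  (hfeat : features_lipschitz Th (V `&` @orthant R m) CPsi)
  (* U and V reach as far as the deviations tolerated by the margin *)
  (hloc : forall t,
     CPsi * kappa * norm2 (omh t - ws) < margin Th r (lam ws) ->
     U (omh t) /\ V (lam (omh t)))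
  (alpha : R) (halpha : 0 < alpha < 1)
  (* the event whose probability is bounded below is an event *)
  (hmeas : measurable [set t | Psi Th (lam (omh t)) = Core r]) :
  sigma ^+ 2 * CPsi ^+ 2 * kappa ^+ 2 / (c0 * margin Th r (lam ws) ^+ 2)
    * ln (2 / alpha) <= N%:R ->
  ((1 - alpha)%:E <= P [set t | Psi Th (lam (omh t)) = Core r])%E.
Proof.
move=> hN; set rho := margin Th r (lam ws) in hrho hloc hN *.
set C := CPsi * kappa in hloc.
have C0 : 0 <= C by rewrite mulr_ge0.
have orth w : Omega w -> orthant (lam w).
  by move=> /hlam[x [mu [_ hi _]]] i; have [] := hi i.
have correct t : C * norm2 (omh t - ws) < rho -> Psi Th (lam (omh t)) = Core r.
  move=> close; have [Ut Vt] := hloc t close.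
  apply/Psi_core/(core_stable hr (orth _ (hOmega t))).
  apply: le_lt_trans close; rewrite distrC.
  apply: le_trans (hfeat _ _ _ _) _.
  - by split=> //; exact: orth.
  - by split; [exact: nbhs_singleton|exact: orth].
  rewrite /C -mulrA ler_wpM2l//; apply: hlip; split=> //.
  exact: nbhs_singleton.
case/andP: halpha => a0 a1.
set A := [set t | _] in hmeas *.
have [C_eq0|C_neq0] := eqVneq C 0.
  have -> : A = setT.
    by apply/seteqP; split=> // t _; apply: correct; rewrite C_eq0 mul0r.
  by rewrite probability_setT lee_fin; lra.
have Cgt0 : 0 < C by rewrite lt_def C_neq0.
suff failure : (P (~` A) <= alpha%:E)%E.
  rewrite -[A]setCK probability_setC; last exact: measurableC.
  by rewrite EFinB leeB.
have s0 : 0 < rho / C by rewrite divr_gt0.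
apply: (@le_trans _ _ (P [set t | rho / C <= norm2 (omh t - ws)]%R)).
  apply: le_measure; rewrite ?inE.
  - exact: measurableC.
  - exact: measurable_closed_tail.
  - move=> t /= nA; rewrite leNgt; apply/negP => lt_s; apply: nA.
    by apply: correct; rewrite mulrC -ltr_pdivlMr.
apply: le_trans (sub_gaussian_closed_tail homh hsub s0) _.
rewrite lee_fin; apply: sub_gaussian_sample_size => //.
by rewrite /C exprMn mulrA.
Qed.
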